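(* Let $X=\{x\}$ be a one-element set and let $i\in\{ls,rs,s\}$. Then the $(X\cup\overline{X^+})$-generated birestriction monoid $\mathcal F_i=\mathrm{BRestr}\langle X\cup\overline{X^+}\mid N_i\rangle$ admits a geometric model.
   Context: A birestriction monoid is an algebra $(S;\cdot,{}^*,{}^+,1)$ such that $(S;\cdot,1)$ is a monoid and for all $x,y$: $xx^*=x$, $x^*y^*=y^*x^*$, $(xy^* )^*=x^*y^*$, $x^*y=y(xy)^*$; $x^+x=x$, $x^+y^+=y^+x^+$, $(x^+y)^+=x^+y^+$, $xy^+=(xy)^+x$; $(x^+)^*=x^+$, $(x^* )^+=x^*$. An inverse monoid is regarded as a birestriction monoid via $a^*=a^{-1}a$, $a^+=aa^{-1}$. An inverse monoid is $E$-unitary if $s\ge e$ with $e$ idempotent implies that $s$ is idempotent. $X^+$ is the free semigroup on $X$; $\overline{X^+}=\{\overline{u}:u\in X^+\}$ is a set disjoint from $X$ in bijection with $X^+$. $\mathrm{BRestr}\langle Y\mid R\rangle$ is the quotient of the free birestriction monoid on $Y$ by the congruence generated by $R$; a relation $a\ge b$ abbreviates $b=ab^*$ (equivalently $b=b^+a$). The sets of relations are $N_{ls}=\{\overline{x}\ge x,\ \overline{u}\,\overline{v}=\overline{u}^{\,+}\overline{uv}: x\in X,\ u,v\in X^+\}$, $N_{rs}=\{\overline{x}\ge x,\ \overline{u}\,\overline{v}=\overline{uv}\,\overline{v}^{\,*}: x\in X,\ u,v\in X^+\}$, $N_s=N_{ls}\cup N_{rs}$. A $Y$-generated birestriction monoid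 $S$ admits a geometric model if there is an injective $(2,1,1,0)$-morphism (preserving $\cdot,{}^*,{}^+,1$) from $S$ into a $Y$-generated $E$-unitary inverse monoid which is $Y$-canonical, i.e. commutes with the assignment maps from $Y$. Here $Y=X\cup\overline{X^+}$. *)

(* Defs.v *)
From HB Require Import structures.
#[warnings="-notation-overridden"]
From mathcomp Require Import all_boot generic_quotient.
From mathcomp Require Import boolp.

Set Warnings "-redundant-canonical-projection".

Set Implicit Arguments.
Unset Strict Implicit.
Unset Printing Implicit Defensive.

Import Algebra.
Local Open Scope group_scope.
Local Open Scope quotient_scope.

Reserved Notation "x ^[*]" (at level 1, left associativity, format "x ^[*]").
Reserved Notation "x ^[+]" (at level 1, left associativity, format "x ^[+]").

HB.mixin Record hasStarPlus G := { star : G -> G; plus : G -> G }.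

#[short(type="biunaryType")]
HB.structure Definition Biunary := {G of hasStarPlus G & ChoiceBaseUMagma G}.

Notation "x ^[*]" := (star x) : group_scope.
Notation "x ^[+]" := (plus x) : group_scope.

HB.mixin Record isBirestriction S of Monoid S & hasStarPlus S := {
  mulg_star : forall x : S, x * x^[*] = x;
  starC : forall x y : S, x^[*] * y^[*] = y^[*] * x^[*];
  starM : forall x y : S, (x * y^[*])^[*] = x^[*] * y^[*];
  star_mul : forall x y : S, x^[*] * y = y * (x * y)^[*];
  plus_mulg : forall x : S, x^[+] * x = x;
  plusC : forall x y : S, x^[+] * y^[+] = y^[+] * x^[+];
  plusM : forall x y : S, (x^[+] * y)^[+] = x^[+] * y^[+];
  mul_plus : forall x y : S, x * y^[+] = (x * y)^[+] * x;
  starP : forall x : S, (x^[+])^[*] = x^[+];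
  plusS : forall x : S, (x^[*])^[+] = x^[*]
}.

#[short(type="birestrType")]
HB.structure Definition Birestr :=
  {S of isBirestriction S & Monoid S & Biunary S}.

Definition nat_ge (S : biunaryType) (a b : S) : Prop := b = a * b^[*].

Section UniqueInverses.
Variables (M : monoidType) (v : M -> M).
Hypothesis invL : forall x, x * v x * x = x.
Hypothesis invR : forall x, v x * x * v x = v x.
Hypothesis invU : forall x y, x * y * x = x -> y * x * y = y -> y = v x.
Implicit Types x y e f : M.

Lemma uinv_idem e : e * e = e -> v e = e.
Proof. by move=> ee; apply/esym/invU; rewrite !ee. Qed.

Lemma uinvK x : v (v x) = x.
Proof. by apply/esym/invU; rewrite ?invL ?invR. Qed.

Let idem_mul e f : e * e = e -> f * f = f -> (e * f) * (e * f) = e * f.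
Proof.
move=> ee ff; set z := v (e * f).
have zz : f * z * e = z.
  apply: invU.
    by rewrite -!mulgA (mulgA e e) ee (mulgA f f) ff !mulgA -(mulgA (e * f * z))
      invL.
  transitivity (f * (z * ((e * e) * (f * f)) * z) * e); first by rewrite !mulgA.
  by rewrite ee ff invR.
have zi : z * z = z.
  rewrite -{1 2}zz; transitivity (f * (z * (e * f) * z) * e); first by rewrite !mulgA.
  by rewrite invR.
have := uinv_idem zi; rewrite /z uinvK => ->.
exact: zi.
Qed.

Lemma uinv_idemC e f : e * e = e -> f * f = f -> e * f = f * e.
Proof.
move=> ee ff; have ef := idem_mul ee ff; have fe := idem_mul ff ee.
rewrite -[LHS](uinv_idem ef); apply/esym/invU.
  by rewrite -[RHS]ef -!mulgA (mulgA f f) ff (mulgA e e) ee.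
by rewrite -[RHS]fe -!mulgA (mulgA e e) ee (mulgA f f) ff.
Qed.

Lemma uinvM x y : v (x * y) = v y * v x.
Proof.
have c : v x * x * (y * v y) = y * v y * (v x * x).
  by apply: uinv_idemC; rewrite mulgA ?invL ?invR.
apply/esym/invU.
  transitivity (x * ((y * v y) * (v x * x)) * y); first by rewrite !mulgA.
  by rewrite -c !mulgA invL -!mulgA (mulgA y) invL.
transitivity (v y * ((v x * x) * (y * v y)) * v x); first by rewrite !mulgA.
by rewrite c !mulgA invR -!mulgA (mulgA (v x)) invR.
Qed.

End UniqueInverses.

(* Every element x has a unique inverse, namely x^-1.  That inversion is an
   involutive antiautomorphism (StarMonoid) is a consequence: see the factory
   Monoid_isInvMonoid. *)
HB.mixin Record StarMonoid_isInvMonoid M of StarMonoid M := {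
  mulgVg : forall x : M, x * x^-1 * x = x;
  mulVgV : forall x : M, x^-1 * x * x^-1 = x^-1;
  inv_uniq : forall x y : M, x * y * x = x -> y * x * y = y -> y = x^-1
}.

#[short(type="invMonoidType")]
HB.structure Definition InvMonoid :=
  {M of StarMonoid_isInvMonoid M & StarMonoid M}.

HB.factory Record Monoid_isInvMonoid M of Monoid M & BaseGroup M := {
  mulgVg : forall x : M, x * x^-1 * x = x;
  mulVgV : forall x : M, x^-1 * x * x^-1 = x^-1;
  inv_uniq : forall x y : M, x * y * x = x -> y * x * y = y -> y = x^-1
}.

HB.builders Context M of Monoid_isInvMonoid M.
HB.instance Definition _ := Monoid_isStarMonoid.Build M
  (uinvK mulgVg mulVgV inv_uniq) (uinvM mulgVg mulVgV inv_uniq).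
HB.instance Definition _ :=
  StarMonoid_isInvMonoid.Build M mulgVg mulVgV inv_uniq.
HB.end.

Section InvMonoidTheory.
Variable M : invMonoidType.
Implicit Types x e f : M.

Lemma idem_inv e : e * e = e -> e^-1 = e.
Proof. exact: (uinv_idem (@inv_uniq M)). Qed.

Lemma idemC e f : e * e = e -> f * f = f -> e * f = f * e.
Proof. exact: (uinv_idemC (@mulgVg M) (@mulVgV M) (@inv_uniq M)). Qed.

Lemma idem_VM x : x^-1 * x * (x^-1 * x) = x^-1 * x.
Proof. by rewrite mulgA mulVgV. Qed.

Lemma idem_MV x : x * x^-1 * (x * x^-1) = x * x^-1.
Proof. by rewrite mulgA mulgVg. Qed.

End InvMonoidTheory.

Definition inv_birestr (M : invMonoidType) : Type := M.

Section InvBirestr.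
Variable M : invMonoidType.
Local Notation B := (inv_birestr M).

HB.instance Definition _ := Monoid.on B.
HB.instance Definition _ := hasStarPlus.Build B
  (fun a : M => a^-1 * a) (fun a : M => a * a^-1).

Fact inv_isBirestriction : isBirestriction B.
Proof.
have idv (e : M) : e * e = e -> e^-1 = e := @idem_inv M e.
split=> [x|x y|x y|x y|x|x y|x y|x y|x|x].
- by rewrite [LHS]mulgA [LHS]mulgVg.
- exact: (idemC (idem_VM (x : M)) (idem_VM (y : M))).
- change ((x * (y^-1 * y))^-1 * (x * (y^-1 * y))
    = x^-1 * x * (y^-1 * y) :> M).
  rewrite invgM (idv _ (idem_VM _)).
  rewrite (mulgA _ x) -(mulgA (y^-1 * y)) -/(_ * _).
  by rewrite (idemC (idem_VM (y : M)) (idem_VM (x : M))) -mulgA idem_VM.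
- change (x^-1 * x * y = y * ((x * y)^-1 * (x * y)) :> M).
  rewrite invgM.
  transitivity ((y * y^-1) * (x^-1 * x) * y : M); last by rewrite !mulgA.
  by rewrite -(idemC (idem_VM (x : M)) (idem_MV (y : M))) -(mulgA (x^-1 * x)) mulgVg.
- exact: (mulgVg (x : M)).
- exact: (idemC (idem_MV (x : M)) (idem_MV (y : M))).
- change ((x * x^-1 * y) * (x * x^-1 * y)^-1 = x * x^-1 * (y * y^-1) :> M).
  rewrite invgM (idv _ (idem_MV _)).
  rewrite (mulgA _ y^-1) -(mulgA (x * x^-1) y).
  by rewrite -(mulgA (x * x^-1)) -(idemC (idem_MV (x : M)) (idem_MV (y : M)))
    (mulgA (x * x^-1)) idem_MV.
- change (x * (y * y^-1) = (x * y) * (x * y)^-1 * x :> M).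
  rewrite invgM.
  transitivity (x * ((y * y^-1) * (x^-1 * x)) : M); last by rewrite !mulgA.
  by rewrite -(idemC (idem_VM (x : M)) (idem_MV (y : M))) !mulgA mulgVg.
- change ((x * x^-1)^-1 * (x * x^-1) = x * x^-1 :> M).
  by rewrite (idv _ (idem_MV _)) idem_MV.
- change ((x^-1 * x) * (x^-1 * x)^-1 = x^-1 * x :> M).
  by rewrite (idv _ (idem_VM _)) idem_VM.
Qed.
HB.instance Definition _ := inv_isBirestriction.
End InvBirestr.

(* On inv_birestr M, nat_ge s e reads e = s * (e^-1 * e): it is the natural
   partial order of M. *)
Definition E_unitary (M : invMonoidType) : Prop :=
  forall s e : inv_birestr M,
    e * e = e -> nat_ge s e -> s * s = s.

Section Quotient.
Variables (A : biunaryType).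

Record congruence (E : A -> A -> Prop) : Prop := Congruence {
  cong_refl : forall a, E a a;
  cong_sym : forall a b, E a b -> E b a;
  cong_trans : forall a b c, E a b -> E b c -> E a c;
  cong_mul : forall a a' b b', E a a' -> E b b' -> E (a * b) (a' * b');
  cong_star : forall a a', E a a' -> E a^[*] a'^[*];
  cong_plus : forall a a', E a a' -> E a^[+] a'^[+]
}.

Definition congr_gen (R : A -> A -> Prop) (a b : A) : Prop :=
  forall E, congruence E -> (forall c d, R c d -> E c d) -> E a b.

Variable R : A -> A -> Prop.

Lemma congr_gen_congruence : congruence (congr_gen R).
Proof.
split=> [a|a b h|a b c h k|a a' b b' h k|a a' h|a a' h] E cE RE.
- exact: (cong_refl cE).
- by apply: (cong_sym cE); apply: h.
- by apply: (cong_trans cE (b := b)); [apply: h | apply: k].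
- by apply: (cong_mul cE); [apply: h | apply: k].
- by apply: (cong_star cE); apply: h.
- by apply: (cong_plus cE); apply: h.
Qed.

Definition congr_genb : rel A := fun a b => `[< congr_gen R a b >].

Lemma congr_genb_refl : reflexive congr_genb.
Proof. by move=> a; apply/asboolP; apply: (cong_refl congr_gen_congruence). Qed.

Lemma congr_genb_sym : symmetric congr_genb.
Proof.
by move=> a b; apply/asboolP/asboolP; apply: (cong_sym congr_gen_congruence).
Qed.

Lemma congr_genb_trans : transitive congr_genb.
Proof.
move=> b a c /asboolP h /asboolP k; apply/asboolP.
exact: (cong_trans congr_gen_congruence h k).
Qed.

Canonical congr_gen_equiv :=
  EquivRel congr_genb congr_genb_refl congr_genb_sym congr_genb_trans.

Definition congr_quot : Type := {eq_quot congr_gen_equiv}.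
HB.instance Definition _ := Choice.on congr_quot.
HB.instance Definition _ := Quotient.on congr_quot.

Lemma congr_quotP (a b : A) :
  \pi_congr_quot a = \pi_congr_quot b <-> congr_gen R a b.
Proof.
split=> [h|h]; first by apply/asboolP/(eqmodP congr_gen_equiv a b).
by apply/(eqmodP congr_gen_equiv a b)/asboolP.
Qed.

Let repr_congr (a : A) : congr_gen R (repr (\pi_congr_quot a)) a.
Proof. by apply/congr_quotP; rewrite reprK. Qed.

Definition quot_mul : congr_quot -> congr_quot -> congr_quot :=
  lift_op2 congr_quot (@mul A).
Definition quot_star : congr_quot -> congr_quot := lift_op1 congr_quot star.
Definition quot_plus : congr_quot -> congr_quot := lift_op1 congr_quot plus.
Definition quot_one : congr_quot := \pi 1.

HB.instance Definition _ := hasMul.Build congr_quot quot_mul.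
HB.instance Definition _ := hasOne.Build congr_quot quot_one.
HB.instance Definition _ := hasStarPlus.Build congr_quot quot_star quot_plus.

Lemma pi_mul (a b : A) :
  \pi_congr_quot (a * b) = (\pi a : congr_quot) * \pi b.
Proof.
rewrite -[RHS]/(quot_mul _ _) /quot_mul -lock; apply/congr_quotP.
by apply: (cong_mul congr_gen_congruence);
  apply: (cong_sym congr_gen_congruence).
Qed.

Lemma pi_star (a : A) : \pi_congr_quot a^[*] = (\pi a : congr_quot)^[*].
Proof.
rewrite -[RHS]/(quot_star _) /quot_star -lock; apply/congr_quotP.
by apply: (cong_star congr_gen_congruence);
  apply: (cong_sym congr_gen_congruence).
Qed.

Lemma pi_plus (a : A) : \pi_congr_quot a^[+] = (\pi a : congr_quot)^[+].
Proof.
rewrite -[RHS]/(quot_plus _) /quot_plus -lock; apply/congr_quotP.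
by apply: (cong_plus congr_gen_congruence);
  apply: (cong_sym congr_gen_congruence).
Qed.

Lemma pi_one : \pi_congr_quot 1 = 1 :> congr_quot.
Proof. by []. Qed.

End Quotient.

Section BirestrQuotient.
Variables (S : birestrType) (R : S -> S -> Prop).
Local Notation Q := (congr_quot R).
Local Notation piE := (pi_mul, pi_star, pi_plus, pi_one).

Let mulA : associative (@mul Q).
Proof. by elim/quotW=> a; elim/quotW=> b; elim/quotW=> c; rewrite -!piE mulgA. Qed.
Let mul1 : left_id 1 (@mul Q).
Proof. by elim/quotW=> a; rewrite -[1]pi_one -!piE mul1g. Qed.
Let mulr1 : right_id 1 (@mul Q).
Proof. by elim/quotW=> a; rewrite -[1]pi_one -!piE mulg1. Qed.

HB.instance Definition _ := Magma_isSemigroup.Build Q mulA.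
HB.instance Definition _ := BaseUMagma_isUMagma.Build Q mul1 mulr1.

Fact quot_isBirestriction : isBirestriction Q.
Proof.
split; try (elim/quotW=> a; try elim/quotW=> b); rewrite -!piE.
- by rewrite mulg_star.
- by rewrite starC.
- by rewrite starM.
- by rewrite star_mul.
- by rewrite plus_mulg.
- by rewrite plusC.
- by rewrite plusM.
- by rewrite mul_plus.
- by rewrite starP.
- by rewrite plusS.
Qed.
HB.instance Definition _ := quot_isBirestriction.
End BirestrQuotient.

Section FreeBirestr.
Variable Y : Type.

Inductive term : Type :=
| Var of Y
| One
| Mul of term & term
| Star of term
| Plus of term.

HB.instance Definition _ := gen_eqMixin term.
HB.instance Definition _ := gen_choiceMixin term.
HB.instance Definition _ := hasMul.Build term Mul.
HB.instance Definition _ := hasOne.Build term One.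
HB.instance Definition _ := hasStarPlus.Build term Star Plus.

Inductive birestr_law : term -> term -> Prop :=
| law_mulA a b c : birestr_law (a * (b * c)) (a * b * c)
| law_mul1g a : birestr_law (1 * a) a
| law_mulg1 a : birestr_law (a * 1) a
| law_mulg_star a : birestr_law (a * a^[*]) a
| law_starC a b : birestr_law (a^[*] * b^[*]) (b^[*] * a^[*])
| law_starM a b : birestr_law (a * b^[*])^[*] (a^[*] * b^[*])
| law_star_mul a b : birestr_law (a^[*] * b) (b * (a * b)^[*])
| law_plus_mulg a : birestr_law (a^[+] * a) a
| law_plusC a b : birestr_law (a^[+] * b^[+]) (b^[+] * a^[+])
| law_plusM a b : birestr_law (a^[+] * b)^[+] (a^[+] * b^[+])
| law_mul_plus a b : birestr_law (a * b^[+]) ((a * b)^[+] * a)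
| law_starP a : birestr_law (a^[+])^[*] a^[+]
| law_plusS a : birestr_law (a^[*])^[+] a^[*].

Definition free_birestr : Type := congr_quot birestr_law.
HB.instance Definition _ := Biunary.on free_birestr.
Local Notation F := free_birestr.
Local Notation piE :=
  (pi_mul birestr_law, pi_star birestr_law, pi_plus birestr_law,
   pi_one birestr_law).

Definition free_gen (y : Y) : F := \pi_(congr_quot birestr_law) (Var y).

Let law a b : birestr_law a b ->
  \pi_(congr_quot birestr_law) a = \pi_(congr_quot birestr_law) b.
Proof. by move=> ab; apply/congr_quotP=> E _; apply. Qed.

Let mulA : associative (@mul F).
Proof.
elim/quotW=> a; elim/quotW=> b; elim/quotW=> c.
by rewrite -!piE; apply/law/law_mulA.
Qed.
Let mul1 : left_id 1 (@mul F).
Proof. by elim/quotW=> a; rewrite -[RHS](law (law_mul1g a)) piE. Qed.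
Let mulr1 : right_id 1 (@mul F).
Proof. by elim/quotW=> a; rewrite -[RHS](law (law_mulg1 a)) piE. Qed.

HB.instance Definition _ := Magma_isSemigroup.Build F mulA.
HB.instance Definition _ := BaseUMagma_isUMagma.Build F mul1 mulr1.

Fact free_isBirestriction : isBirestriction F.
Proof.
by split; try (elim/quotW=> a; try elim/quotW=> b); rewrite -?piE;
  apply: law; constructor.
Qed.
HB.instance Definition _ := free_isBirestriction.

End FreeBirestr.

(* Generation is in the respective signature: (.,*,+,1) for birestriction
   monoids, (.,^-1,1) for inverse monoids. *)
Definition birestr_generates (Y : Type) (S : birestrType) (i : Y -> S) : Prop :=
  forall P : S -> Prop,
    (forall y, P (i y)) -> P 1 -> (forall a b, P a -> P b -> P (a * b)) ->
    (forall a, P a -> P a^[*]) -> (forall a, P a -> P a^[+]) ->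
  forall a, P a.

Definition inv_generates (Y : Type) (M : invMonoidType) (j : Y -> M) : Prop :=
  forall P : M -> Prop,
    (forall y, P (j y)) -> P 1 -> (forall a b, P a -> P b -> P (a * b)) ->
    (forall a, P a -> P a^-1) ->
  forall a, P a.

Record genBirestr (Y : Type) := GenBirestr {
  gb_sort :> birestrType;
  gb_gen : Y -> gb_sort;
  gb_generates : birestr_generates gb_gen
}.

Record genInvMonoid (Y : Type) := GenInvMonoid {
  gi_sort :> invMonoidType;
  gi_gen : Y -> gi_sort;
  gi_generates : inv_generates gi_gen
}.

Record birestr_morphism (S T : birestrType) (f : S -> T) : Prop := {
  bm_mul : forall a b, f (a * b) = f a * f b;
  bm_star : forall a, f a^[*] = (f a)^[*];
  bm_plus : forall a, f a^[+] = (f a)^[+];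
  bm_one : f 1 = 1
}.

Definition admits_geometric_model (Y : Type) (S : genBirestr Y) : Prop :=
  exists (M : genInvMonoid Y) (f : S -> inv_birestr M),
    [/\ E_unitary M, birestr_morphism f, injective f &
        forall y, f (gb_gen S y) = gi_gen M y].

Section Presentation.
Variables (Y : Type) (R : free_birestr Y -> free_birestr Y -> Prop).

Definition pres_gen (y : Y) : congr_quot R :=
  \pi_(congr_quot R) (free_gen y).

Fact pres_generates : birestr_generates pres_gen.
Proof.
move=> P Pg P1 PM PS PP; elim/quotW; elim/quotW; elim=> [y||a Pa b Pb|a Pa|a Pa].
- exact: Pg.
- exact: P1.
- have -> : Mul a b = a * b by [].
  by rewrite !pi_mul; apply: PM.
- have -> : Star a = a^[*] by [].
  by rewrite !pi_star; apply: PS.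
- have -> : Plus a = a^[+] by [].
  by rewrite !pi_plus; apply: PP.
Qed.

Definition BRestr : genBirestr Y := GenBirestr pres_generates.
End Presentation.

Section FreeSemigroup.
Variable X : Type.

Definition free_semigroup : Type := {w : seq X | ~~ nilp w}.
Definition fs_letter (x : X) : free_semigroup :=
  exist (fun w => ~~ nilp w) [:: x] isT.

Fact fs_cat_subproof (u v : free_semigroup) : ~~ nilp (val u ++ val v).
Proof. by case: u => [[|x u] //= _]. Qed.
Definition fs_cat (u v : free_semigroup) : free_semigroup :=
  exist (fun w => ~~ nilp w) (val u ++ val v) (fs_cat_subproof u v).
End FreeSemigroup.

Section Relations.
Variable X : Type.
Local Notation Y := (X + free_semigroup X)%type.
Local Notation F := (free_birestr Y).

Definition letter (x : X) : F := free_gen (inl x).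
Definition bar (u : free_semigroup X) : F := free_gen (inr u).

(* A relation a >= b stands for the pair (b, a b^* ). *)
Inductive N_ls : F -> F -> Prop :=
| N_ls_ge x :
    N_ls (letter x) (bar (fs_letter x) * (letter x)^[*])
| N_ls_mul u v :
    N_ls (bar u * bar v) ((bar u)^[+] * bar (fs_cat u v)).

Inductive N_rs : F -> F -> Prop :=
| N_rs_ge x :
    N_rs (letter x) (bar (fs_letter x) * (letter x)^[*])
| N_rs_mul u v :
    N_rs (bar u * bar v) (bar (fs_cat u v) * (bar v)^[*]).

Definition N_s (a b : F) : Prop := N_ls a b \/ N_rs a b.

Inductive N_index := i_ls | i_rs | i_s.

Definition N_rel (i : N_index) : F -> F -> Prop :=
  match i with i_ls => N_ls | i_rs => N_rs | i_s => N_s end.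

Definition F_monoid (i : N_index) : genBirestr Y := BRestr (N_rel i).
End Relations.

(* Main.v *)
(* Let F be one of the three monoids and let b_n be the bar of x^n, b_0 = 1.
   Counting letters gives a degree F -> nat, and every s in F lies below b_n,
   where n = deg s; hence s is determined by n and either of s^+ and s^*.

   Suppose that s^+ = t^+ and deg s <= deg t.  Left strength
   b_m b_n = b_m^+ b_(m+n) gives s r = t with r^+ = s^*.  Hence cospans of
   projections e --s--> . <--t-- f, graded by deg s - deg t, compose: the two
   inner legs start at the same projection and so one factors through the other.
   They define a partial action of the group of integers on the projections.  The
   restrictions of the partial bijections of a partial group action, together with
   their degrees, form an inverse monoid under composition; it is E-unitary since a
   partial bijection of degree 0 is a partial identity.  Sending s to its degree
   and its Munn action on projections embeds F into this monoid.  The right strong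
   case is dual, with spans. *)

From HB Require Import structures.
#[warnings="-notation-overridden"]
From mathcomp Require Import all_boot ssralg ssrint generic_quotient.
From mathcomp Require Import boolp zify.
Require Import Defs.

Set Implicit Arguments.
Unset Strict Implicit.
Unset Printing Implicit Defensive.

Import Algebra GRing.Theory.
Local Open Scope group_scope.
Local Open Scope quotient_scope.

(** * Inverse submonoids and geometric models *)

Section GeneratedSubmonoid.
Variables (Y : Type) (M : invMonoidType) (j : Y -> M).

Inductive generated : M -> Prop :=
| generated_gen y : generated (j y)
| generated1 : generated 1
| generatedM a b : generated a -> generated b -> generated (a * b)
| generatedV a : generated a -> generated a^-1.

Definition gen_sub : Type := {a : M | generated a}.
HB.instance Definition _ := gen_eqMixin gen_sub.
HB.instance Definition _ := gen_choiceMixin gen_sub.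

Implicit Types u v : gen_sub.

Lemma gen_sub_inj u v : sval u = sval v -> u = v.
Proof. by case: u v => [a ga] [b gb] /= eab; apply: eq_exist. Qed.

HB.instance Definition _ := hasMul.Build gen_sub
  (fun u v => exist _ (sval u * sval v) (generatedM (proj2_sig u) (proj2_sig v))).
HB.instance Definition _ := hasOne.Build gen_sub (exist _ 1 generated1).
HB.instance Definition _ := hasInv.Build gen_sub
  (fun u => exist _ (sval u)^-1 (generatedV (proj2_sig u))).

Let mulA : associative (@mul gen_sub).
Proof. by move=> u v w; apply: gen_sub_inj; apply: mulgA. Qed.
Let mul1 : left_id 1 (@mul gen_sub).
Proof. by move=> u; apply: gen_sub_inj; apply: mul1g. Qed.
Let mulr1 : right_id 1 (@mul gen_sub).
Proof. by move=> u; apply: gen_sub_inj; apply: mulg1. Qed.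
HB.instance Definition _ := Magma_isSemigroup.Build gen_sub mulA.
HB.instance Definition _ := BaseUMagma_isUMagma.Build gen_sub mul1 mulr1.

Let invL u : u * u^-1 * u = u.
Proof. by apply: gen_sub_inj; apply: mulgVg. Qed.
Let invR u : u^-1 * u * u^-1 = u^-1.
Proof. by apply: gen_sub_inj; apply: mulVgV. Qed.
Let invU u v : u * v * u = u -> v * u * v = v -> v = u^-1.
Proof.
by move=> /(congr1 sval) h /(congr1 sval) k; apply: gen_sub_inj; apply: inv_uniq.
Qed.
HB.instance Definition _ := Monoid_isInvMonoid.Build gen_sub invL invR invU.

Definition gen_sub_gen (y : Y) : gen_sub := exist _ (j y) (generated_gen y).

Lemma gen_sub_generates : inv_generates gen_sub_gen.
Proof.
move=> P Pg P1 PM PV [a ga]; pose el b gb : gen_sub := exist _ b gb.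
have elE b gb gb' : el b gb = el b gb' by apply: gen_sub_inj.
rewrite -/(el a ga); elim: ga (ga) => {a}.
- by move=> y gy; rewrite (elE _ gy (generated_gen y)); apply: Pg.
- by move=> g1; rewrite (elE _ g1 generated1); apply: P1.
- move=> a b ga Pa gb Pb gab; rewrite (elE _ gab (generatedM ga gb)).
  exact: (PM (el a ga) (el b gb)).
- move=> a ga Pa gV; rewrite (elE _ gV (generatedV ga)).
  exact: (PV (el a ga)).
Qed.

Lemma gen_sub_E_unitary : E_unitary M -> E_unitary gen_sub.
Proof.
move=> EM s e /(congr1 sval) ee /(congr1 sval) se; apply: gen_sub_inj.
exact: (EM (sval s) (sval e)).
Qed.

End GeneratedSubmonoid.

(** A model has to be generated by [Y], so [M] is cut down to the inverse submonoid generated by the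
    images of [Y]. It contains the image of [f], since star and plus are products of an element and
    its inverse. *)
Lemma geometric_model_of_embedding (Y : Type) (S : genBirestr Y)
    (M : invMonoidType) (f : S -> inv_birestr M) :
  E_unitary M -> birestr_morphism f -> injective f -> admits_geometric_model S.
Proof.
move=> EM [fM fS fP f1] finj; pose j y : M := f (gb_gen S y).
have gf (s : S) : generated j (f s).
  elim/(@gb_generates _ S): s => [y||a b ga gb|a ga|a ga].
  - exact: generated_gen.
  - by rewrite f1; apply: generated1.
  - by rewrite fM; apply: generatedM.
  - by rewrite fS; apply: generatedM => //; apply: generatedV.
  - by rewrite fP; apply: generatedM => //; apply: generatedV.
exists (GenInvMonoid (@gen_sub_generates _ _ j)).
exists (fun s => exist _ (f s) (gf s)); split=> [||s t /(congr1 sval)|y].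
- exact: gen_sub_E_unitary.
- split=> [a b|a|a|]; apply: gen_sub_inj.
  + exact: fM.
  + exact: fS.
  + exact: fP.
  + exact: f1.
- exact: finj.
- exact: gen_sub_inj.
Qed.

(** * Partial group actions *)

(** [pa0] and [paD] are inclusions only. With [paN] they already make each [phi g] a partial
    injection. *)
Record partial_action (G : zmodType) (T : Type) := PartialAction {
  pa_rel :> G -> T -> T -> Prop;
  pa0 : forall a b, pa_rel 0%R a b -> a = b;
  paN : forall g a b, pa_rel g a b -> pa_rel (- g)%R b a;
  paD : forall g h a b c, pa_rel g a b -> pa_rel h b c -> pa_rel (g + h)%R a c
}.

Section PartialActionMonoid.
Variables (G : zmodType) (T : Type) (phi : partial_action G T).

Lemma pa_fun g a b c : phi g a b -> phi g a c -> b = c.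
Proof.
move=> ab ac; apply: (@pa0 _ _ phi); rewrite -(addNr g).
exact: paD (paN ab) ac.
Qed.

Lemma pa_inj g a b c : phi g a c -> phi g b c -> a = b.
Proof.
move=> ac bc; apply: (@pa0 _ _ phi); rewrite -(subrr g).
exact: paD ac (paN bc).
Qed.

Lemma pa_dom g a b : phi g a b -> phi 0%R a a.
Proof. by move=> ab; rewrite -(subrr g); exact: paD ab (paN ab). Qed.

Lemma pa_cod g a b : phi g a b -> phi 0%R b b.
Proof. by move=> ab; exact: pa_dom (paN ab). Qed.

(* The unit is [phi 0], which may be a proper restriction of the identity. *)
Record graded_rel := GradedRel {
  gr_deg : G;
  gr_rel : T -> T -> Prop;
  gr_sub : forall a b, gr_rel a b -> phi gr_deg a b
}.

HB.instance Definition _ := gen_eqMixin graded_rel.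
HB.instance Definition _ := gen_choiceMixin graded_rel.

Implicit Types x y z : graded_rel.

Lemma graded_relP x y : gr_deg x = gr_deg y ->
  (forall a b, gr_rel x a b <-> gr_rel y a b) -> x = y.
Proof.
case: x y => [g r rs] [h q qs] /= gh rq; case: h / gh qs => qs.
have erq : r = q by apply/funext => a; apply/funext => b; apply/propext.
case: q / erq qs {rq} => qs.
by rewrite (Prop_irrelevance rs qs).
Qed.

Fact gr_mul_subproof x y a c :
  (exists2 b, gr_rel x a b & gr_rel y b c) -> phi (gr_deg x + gr_deg y)%R a c.
Proof. by move=> [b /gr_sub ab /gr_sub bc]; exact: paD ab bc. Qed.

HB.instance Definition _ := hasMul.Build graded_rel
  (fun x y => GradedRel (@gr_mul_subproof x y)).
HB.instance Definition _ := hasOne.Build graded_rel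
  (@GradedRel 0%R (phi 0%R) (fun a b => id)).
HB.instance Definition _ := hasInv.Build graded_rel
  (fun x => @GradedRel (- gr_deg x)%R (fun a b => gr_rel x b a)
    (fun a b ba => paN (gr_sub ba))).

Let mulA : associative (@mul graded_rel).
Proof.
move=> x y z; apply: graded_relP => [|a d /=]; first exact: addrA.
split=> [[b ab [c bc cd]]|[c [b ab bc] cd]].
- by exists c => //; exists b.
- by exists b => //; exists c.
Qed.
Let mul1 : left_id 1 (@mul graded_rel).
Proof.
move=> x; apply: graded_relP => [|a c /=]; first exact: add0r.
split=> [[b ab bc]|ac]; first by rewrite (pa0 ab).
exists a => //; exact: pa_dom (gr_sub ac).
Qed.
Let mulr1 : right_id 1 (@mul graded_rel).
Proof.
move=> x; apply: graded_relP => [|a c /=]; first exact: addr0.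
split=> [[b ab bc]|ac]; first by rewrite -(pa0 bc).
exists c => //; exact: pa_cod (gr_sub ac).
Qed.
HB.instance Definition _ := Magma_isSemigroup.Build graded_rel mulA.
HB.instance Definition _ := BaseUMagma_isUMagma.Build graded_rel mul1 mulr1.

Let invL x : x * x^-1 * x = x.
Proof.
apply: graded_relP => [|a d /=]; first by rewrite /= subrr add0r.
split=> [[c [b ab cb] cd]|ad]; last by exists a => //; exists d.
by rewrite (pa_inj (gr_sub ab) (gr_sub cb)).
Qed.
Let invR x : x^-1 * x * x^-1 = x^-1.
Proof.
apply: graded_relP => [|a d /=]; first by rewrite /= addNr add0r.
split=> [[c [b ba bc] dc]|da]; last by exists a => //; exists d.
by rewrite (pa_fun (gr_sub ba) (gr_sub bc)).
Qed.

(** A pair [a], [b] of [x] factors through [x * y * x] as a path [a], [d], [c], [b]. Here [d = b]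
    and [c = a], because [x] is a partial injection. *)
Let sub_inv x y a b : x * y * x = x -> gr_rel x a b -> gr_rel y b a.
Proof.
move=> xyx; rewrite -{1}xyx => -[c [d ad dc] cb].
have xab : gr_rel x a b by rewrite -xyx; exists c => //; exists d.
rewrite -(pa_fun (gr_sub ad) (gr_sub xab)).
by rewrite (pa_inj (gr_sub xab) (gr_sub cb)).
Qed.

Let invU x y : x * y * x = x -> y * x * y = y -> y = x^-1.
Proof.
move=> xyx yxy; apply: graded_relP => [/=|a b /=]; last first.
  by split; [apply: sub_inv yxy | apply: sub_inv xyx].
(* The degree needs its own argument: an empty relation does not determine it. *)
have /= /(canRL (addrK _)) := congr1 gr_deg xyx.
by rewrite subrr => /eqP; rewrite addrC addr_eq0 => /eqP.
Qed.
HB.instance Definition _ := Monoid_isInvMonoid.Build graded_rel invL invR invU.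

(** An idempotent has degree 0 and an element above it has the same degree, even when the idempotent
    is an empty relation. Hence [s] is contained in [phi 0], that is, in the identity. *)
Lemma graded_rel_E_unitary : E_unitary graded_rel.
Proof.
move=> s e ee se.
have e0 : gr_deg e = 0%R.
  have /= /(canRL (addrK _)) := congr1 gr_deg (ee : e * e = e :> graded_rel).
  by rewrite subrr.
have s0 : gr_deg s = 0%R.
  have /= := congr1 gr_deg (se : e = s * (e^-1 * e) :> graded_rel).
  by rewrite e0 oppr0 !addr0.
apply: (@graded_relP (s * s) s) => [|a c]; first by rewrite /= s0 addr0.
have sid u v : gr_rel s u v -> u = v.
  by move=> uv; apply: (@pa0 _ _ phi); rewrite -s0; exact: gr_sub uv.
by split=> [/= [b ab bc]|ac]; [rewrite (sid _ _ ab) | exists c => //=;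
  rewrite -{1}(sid _ _ ac)].
Qed.

End PartialActionMonoid.

(** * The natural order of a birestriction monoid *)

Section BirestrTheory.
Variable S : birestrType.
Implicit Types s t u e : S.

Lemma plusK s : s^[+]^[+] = s^[+].
Proof. by rewrite -[s^[+] in LHS]starP plusS starP. Qed.

Lemma starK s : s^[*]^[*] = s^[*].
Proof. by rewrite -[s^[*] in LHS]plusS starP plusS. Qed.

Lemma plus1 : (1 : S)^[+] = 1.
Proof. by rewrite -[LHS]mulg1 plus_mulg. Qed.

Lemma star1 : (1 : S)^[*] = 1.
Proof. by rewrite -plus1 starP. Qed.

Lemma plus_mul_plus s t : (s * t^[+])^[+] = (s * t)^[+].
Proof. by rewrite mul_plus plusM plusC -plusM mulgA plus_mulg. Qed.

Lemma star_mul_star s t : (s^[*] * t)^[*] = (s * t)^[*].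
Proof. by rewrite star_mul starM starC -starM -mulgA mulg_star. Qed.

Lemma plusM_absorb s t : (s * t)^[+] * s^[+] = (s * t)^[+].
Proof. by rewrite plusC -plusM mulgA plus_mulg. Qed.

Lemma restrict_star e s : e^[+] * s = s * (e^[+] * s)^[*].
Proof. by rewrite -star_mul starP. Qed.

Lemma restrict_plus s e : s * e^[*] = (s * e^[*])^[+] * s.
Proof. by rewrite -mul_plus plusS. Qed.

Lemma composable_plus s t : s^[*] = t^[+] -> (s * t)^[+] = s^[+].
Proof. by move=> st; rewrite -plus_mul_plus -st mulg_star. Qed.

Lemma composable_star s t : s^[*] = t^[+] -> (s * t)^[*] = t^[*].
Proof. by move=> st; rewrite -star_mul_star st plus_mulg. Qed.

(** By [mul_plus], the assumption gives [s * t^[+] = s^[+] * s = s]; then take the star. *)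
Lemma star_of_plus_mul s t : (s * t)^[+] = s^[+] -> s^[*] * t^[+] = s^[*].
Proof. by move=> st; rewrite -starP -starM starP mul_plus st plus_mulg. Qed.

Lemma plus_of_mul_star s t : (s * t)^[*] = t^[*] -> s^[*] * t^[+] = t^[+].
Proof.
move=> st; rewrite -[s^[*]]plusS -plusM plusS star_mul st.
by rewrite mulg_star.
Qed.

(* The action of [s] by partial bijections on projections: it sends [t^+] to
   [t^*] for each [t] below [s] in the natural order. *)
Definition munn_rel s (e f : S) : Prop :=
  exists t, [/\ t = t^[+] * s, t^[+] = e & t^[*] = f].

Lemma munn_relM s u e f : munn_rel (s * u) e f <->
  exists2 g, munn_rel s e g & munn_rel u g f.
Proof.
split=> [[t [ts <- <-]]|[g [t [ts <- <-]] [r [ru rg <-]]]].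
(* The element [t] below [s * u] splits into [t1] below [s] and [t1^[*] * u] below [u], which meet
   at the projection [t1^[*]]. *)
- pose t1 := t^[+] * s; have tt1 : t = t1 * u by rewrite /t1 -mulgA.
  have t1p : t1^[+] = t^[+].
    rewrite /t1 plusM.
    have -> : t^[+] = t^[+] * (s * u)^[+] by rewrite -plusM -ts.
    by rewrite -mulgA plusM_absorb.
  have t1u : t1^[*] * u^[+] = t1^[*].
    by apply: star_of_plus_mul; rewrite -tt1.
  exists t1^[*]; first by exists t1; split=> //; rewrite t1p.
  have rp : (t1^[*] * u)^[+] = t1^[*] by rewrite -[t1^[*]]plusS plusM plusS.
  by exists (t1^[*] * u); split=> //; rewrite ?rp // star_mul_star -tt1.
- have tr : t^[*] = r^[+] by [].
  exists (t * r); rewrite composable_plus // composable_star //; split=> //.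
  by rewrite {1}ru -tr !mulgA mulg_star {1}ts.
Qed.

Lemma munn_rel_plus s e f : munn_rel s^[+] e f <->
  [/\ e^[+] = e, e * s^[+] = e & f = e].
Proof.
split=> [[t [ts <- <-]]|[ep es ->]].
- have tp : t^[+] = t by rewrite ts plusM plusK.
  by rewrite plusK -ts tp; split=> //; rewrite -{1}tp starP tp.
- by exists e; rewrite ep es; split=> //; rewrite -ep starP.
Qed.

Lemma munn_rel_star s e f : munn_rel s^[*] e f <->
  [/\ e^[+] = e, e * s^[*] = e & f = e].
Proof. by rewrite -[s^[*]]plusS; apply: munn_rel_plus. Qed.

Lemma munn_rel_dom s e f : munn_rel s e f -> e^[+] = e /\ e * s^[+] = e.
Proof.
by move=> [t [ts <- _]]; rewrite plusK; split=> //; rewrite -plusM -ts.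
Qed.

Lemma munn_rel_cod s e f : munn_rel s e f -> f^[+] = f /\ f * s^[*] = f.
Proof.
move=> [t [ts _ <-]]; rewrite plusS; split=> //.
have t2 : t = s * t^[*] by rewrite {1}ts restrict_star -ts.
by rewrite starC -starM -t2.
Qed.

Lemma munn_rel_ex s e : e^[+] = e -> e * s^[+] = e -> exists f, munn_rel s e f.
Proof.
move=> ep es; exists (e * s)^[*]; exists (e * s).
have p : (e * s)^[+] = e by rewrite -ep plusM ep.
by rewrite p.
Qed.

Lemma munn_rel_ex_cod s f : f^[+] = f -> f * s^[*] = f ->
  exists e, munn_rel s e f.
Proof.
move=> fp fs; exists (s * f)^[+]; exists (s * f); split=> //.
- by rewrite -mul_plus fp.
- by rewrite -fp -starP starM starC starP fp.
Qed.

Lemma munn_rel_self s : munn_rel s s^[+] s^[*].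
Proof. by exists s; rewrite plus_mulg. Qed.

End BirestrTheory.

(** * Embedding by degree and Munn action *)

Section Embedding.
Variables (Y : Type) (S : genBirestr Y) (G : zmodType).
Variables (deg : S -> G) (phi : partial_action G S).
Hypothesis degM : forall s t, deg (s * t) = (deg s + deg t)%R.
Hypothesis phi_deg : forall s, phi (deg s) s^[+] s^[*].
Hypothesis phi0_proj : forall e f, phi 0%R e f -> e^[+] = e.
Hypothesis proper : forall s t, s^[+] = t^[+] -> deg s = deg t -> s = t.

Let deg_star s : deg s^[*] = 0%R.
Proof. by apply: (addrI (deg s)); rewrite addr0 -degM mulg_star. Qed.

Let deg_plus s : deg s^[+] = 0%R.
Proof. by rewrite -starP deg_star. Qed.

Let deg1 : deg 1 = 0%R.
Proof. by rewrite -(deg_plus 1) plus1. Qed.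

Fact munn_rel_sub s e f : munn_rel s e f -> phi (deg s) e f.
Proof.
move=> [t [ts <- <-]]; have -> : deg s = deg t by rewrite ts degM deg_plus add0r.
exact: phi_deg.
Qed.

Let phi_diag e : e^[+] = e -> phi 0%R e e.
Proof.
by move=> ep; have := phi_deg e; rewrite -{1 3}ep deg_plus starP ep.
Qed.

Let emb s : inv_birestr (graded_rel phi) := GradedRel (@munn_rel_sub s).

Let emb_morphism : birestr_morphism emb.
Proof.
split=> [s t|s|s|].
- apply: (@graded_relP _ _ _ (emb (s * t)) (mul (emb s : graded_rel phi) (emb t))).
    exact: degM.
  exact: munn_relM.
- apply: (@graded_relP _ _ _ (emb s^[*])
      (mul (inv (emb s : graded_rel phi)) (emb s))) => [|e f /=].
    by rewrite /= deg_star addNr.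
  split=> [/munn_rel_star[ep es ->]|[g /[dup] ge + gf]].
    by have [g ge] := munn_rel_ex_cod ep es; exists g.
  move=> /munn_rel_cod[ep es]; apply/munn_rel_star; split=> //.
  by have := pa_fun (munn_rel_sub gf) (munn_rel_sub ge).
- apply: (@graded_relP _ _ _ (emb s^[+])
      (mul (emb s : graded_rel phi) (inv (emb s : graded_rel phi)))) => [|e f /=].
    by rewrite /= deg_plus subrr.
  split=> [/munn_rel_plus[ep es ->]|[g /[dup] eg + fg]].
    by have [g eg] := munn_rel_ex ep es; exists g.
  move=> /munn_rel_dom[ep es]; apply/munn_rel_plus; split=> //.
  by have := pa_inj (munn_rel_sub fg) (munn_rel_sub eg).
- apply: (@graded_relP _ _ _ (emb 1) (one : graded_rel phi)) => [|e f /=].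
    exact: deg1.
  (* The element 1 acts as the identity on all projections, and [phi0_proj] confines the unit
     [phi 0] of the model to projections. *)
  rewrite -plus1; split=> [/munn_rel_plus[ep _ ->]|ef]; first exact: phi_diag.
  apply/munn_rel_plus; rewrite plus1 mulg1 (pa0 ef); split=> //.
  by rewrite -(pa0 ef); apply: phi0_proj ef.
Qed.

(** The domain of the Munn action of [s] has greatest element [s^[+]], so the action and the degree
    together determine [s] by [proper]. *)
Let emb_inj : injective emb.
Proof.
move=> s t st; apply: proper (congr1 (@gr_deg _ _ _) st).
have rel_st := congr1 (@gr_rel _ _ _) st.
have /munn_rel_dom[_ <-] : munn_rel t s^[+] s^[*].
  by rewrite -[munn_rel t]rel_st; apply: munn_rel_self.
have /munn_rel_dom[_ {2}<-] : munn_rel s t^[+] t^[*].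
  by rewrite [munn_rel s]rel_st; apply: munn_rel_self.
exact: plusC.
Qed.

Theorem geometric_model_of_partial_action : admits_geometric_model S.
Proof.
exact: geometric_model_of_embedding (@graded_rel_E_unitary _ _ phi)
  emb_morphism emb_inj.
Qed.

End Embedding.

(** * Division with respect to a degree *)

Section Division.
Variables (Y : Type) (S : genBirestr Y) (deg : S -> nat).
Hypothesis degM : forall s t, deg (s * t) = (deg s + deg t)%N.

Let deg_star s : deg s^[*] = 0%N.
Proof. by apply: (@addnI (deg s)); rewrite -degM mulg_star addn0. Qed.

Let deg_plus s : deg s^[+] = 0%N.
Proof. by rewrite -starP deg_star. Qed.

Hypothesis proper : forall s t, s^[+] = t^[+] -> deg s = deg t -> s = t.

Section Left.
Hypothesis ldiv : forall s t, s^[+] = t^[+] -> (deg s <= deg t)%N ->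
  exists2 r, s * r = t & r^[+] = s^[*].
Hypothesis proper_star : forall s t, s^[*] = t^[*] -> deg s = deg t -> s = t.

Let cospan (g : int) (e f : S) : Prop := exists s t,
  [/\ s^[+] = e, t^[+] = f, s^[*] = t^[*] & (Posz (deg s) - Posz (deg t) = g)%R].

(** Dividing gives [t * r = s']. Multiplying both legs of the cospan [s], [t] by [r] keeps its outer
    projections and its grade, and turns the inner leg into [s']. *)
Let cospan_extend s t s' : s^[*] = t^[*] -> t^[+] = s'^[+] ->
  (deg t <= deg s')%N ->
  exists s1, [/\ s1^[+] = s^[+], s1^[*] = s'^[*] &
    (deg s1 + deg t = deg s + deg s')%N].
Proof.
move=> st tt' le_t; have [r <- rt] := ldiv tt' le_t; exists (s * r).
by rewrite !degM composable_plus ?composable_star ?rt //; split=> //; lia.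
Qed.

Let cospan0 e f : cospan 0%R e f -> e = f.
Proof.
move=> [s [t [<- <- st dst]]]; congr _^[+]; apply: proper_star st _; lia.
Qed.

Let cospanN g e f : cospan g e f -> cospan (- g)%R f e.
Proof. by move=> [s [t [se tf st <-]]]; exists t, s; split=> //; lia. Qed.

Let cospanD g h e f k : cospan g e f -> cospan h f k -> cospan (g + h)%R e k.
Proof.
move=> [s [t [se tf st dg]]] [s' [t' [sf tk st' dh]]].
(* The inner legs [t] and [s'] start at [f]. The cospan whose inner leg has the smaller degree is
   extended until the two inner legs agree. *)
case: (leqP (deg t) (deg s')) => [le_t|/ltnW le_t].
- have [|s1 [s1e s1s' ds1]] := cospan_extend st _ le_t; first by rewrite tf.
  by exists s1, t'; rewrite s1e s1s'; split=> //; lia.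
- have [|t1 [t1e t1t dt1]] := cospan_extend (esym st') _ le_t.
    by rewrite tf.
  by exists s, t1; rewrite t1e t1t; split=> //; lia.
Qed.

Lemma geometric_model_of_left_division : admits_geometric_model S.
Proof.
apply: (@geometric_model_of_partial_action _ _ _ (fun s => Posz (deg s))
  (PartialAction cospan0 cospanN cospanD)) => //= [s t|s|e f|s t st [dst]].
- by rewrite degM.
- by exists s, s^[*]; rewrite plusS starK deg_star; split=> //; lia.
- by move=> [s [t [<- _ _ _]]]; rewrite plusK.
- exact: proper.
Qed.
End Left.

Section Right.
Hypothesis rdiv : forall s t, s^[*] = t^[*] -> (deg s <= deg t)%N ->
  exists2 r, r * s = t & r^[*] = s^[+].

(** The sign is opposite to that of [cospan]: the span from [s^[+]] to [s^[*]] has [s] as its second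
    leg, the first being the projection [s^[+]]. *)
Let span (g : int) (e f : S) : Prop := exists s t,
  [/\ s^[*] = e, t^[*] = f, s^[+] = t^[+] & (Posz (deg t) - Posz (deg s) = g)%R].

Let span_extend s t s' : s^[+] = t^[+] -> t^[*] = s'^[*] ->
  (deg t <= deg s')%N ->
  exists s1, [/\ s1^[*] = s^[*], s1^[+] = s'^[+] &
    (deg s1 + deg t = deg s + deg s')%N].
Proof.
move=> st tt' le_t; have [r <- rt] := rdiv tt' le_t; exists (r * s).
by rewrite !degM composable_star ?composable_plus ?rt //; split=> //; lia.
Qed.

Let span0 e f : span 0%R e f -> e = f.
Proof.
by move=> [s [t [<- <- st dst]]]; congr _^[*]; apply: proper st _; lia.
Qed.

Let spanN g e f : span g e f -> span (- g)%R f e.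
Proof. by move=> [s [t [se tf st <-]]]; exists t, s; split=> //; lia. Qed.

Let spanD g h e f k : span g e f -> span h f k -> span (g + h)%R e k.
Proof.
move=> [s [t [se tf st dg]]] [s' [t' [sf tk st' dh]]].
case: (leqP (deg t) (deg s')) => [le_t|/ltnW le_t].
- have [|s1 [s1e s1s' ds1]] := span_extend st _ le_t; first by rewrite tf.
  by exists s1, t'; rewrite s1e s1s'; split=> //; lia.
- have [|t1 [t1e t1t dt1]] := span_extend (esym st') _ le_t.
    by rewrite tf.
  by exists s, t1; rewrite t1e t1t; split=> //; lia.
Qed.

Lemma geometric_model_of_right_division : admits_geometric_model S.
Proof.
apply: (@geometric_model_of_partial_action _ _ _ (fun s => Posz (deg s))
  (PartialAction span0 spanN spanD)) => //= [s t|s|e f|s t st [dst]].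
- by rewrite degM.
- by exists s^[+], s; rewrite starP plusK deg_plus; split=> //; lia.
- by move=> [s [t [<- _ _ _]]]; rewrite plusS.
- exact: proper.
Qed.
End Right.
End Division.

(** * Elements below a graded family *)

Section Transversal.
Variables (Y : Type) (S : genBirestr Y) (deg : S -> nat) (b : nat -> S).
Hypothesis degM : forall s t, deg (s * t) = (deg s + deg t)%N.
Hypothesis deg_b : forall n, deg (b n) = n.
Hypothesis b0 : b 0 = 1.
Hypothesis bM : forall m n, exists e, b m * b n = e^[+] * b (m + n).
Hypothesis gen_below : forall y, exists e n, gb_gen S y = e^[+] * b n.

(** Projections lie below [b 0 = 1]. Products stay below the family, since [mul_plus] moves a
    projection to the left past [b m]. The index is the degree because projections have degree 0. *)
Lemma below_b s : s = s^[+] * b (deg s).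
Proof.
have [e [n se]] : exists e n, s = e^[+] * b n.
  elim/(@gb_generates _ S): s => [//||s t [e [m ->]] [f [n ->]]|s _|s _].
  - by exists 1, 0; rewrite b0 plus1 mulg1.
  - have [c cE] := bM m n.
    exists (e^[+] * ((b m * f)^[+] * c)), (m + n).
    by rewrite !plusM -!mulgA -cE !mulgA -(mulgA _ (b m)) mul_plus !mulgA.
  - by exists s^[*], 0; rewrite b0 plusS mulg1.
  - by exists s^[+], 0; rewrite b0 plusK mulg1.
have ds : deg s = n.
  have dp : deg e^[+] = 0%N.
    by apply: (@addIn (deg e)); rewrite -degM plus_mulg.
  by rewrite se degM dp deg_b.
by rewrite ds {1 2}se plusM -mulgA plus_mulg.
Qed.

Lemma below_b_star s : s = b (deg s) * s^[*].
Proof. by rewrite {1}[s]below_b restrict_star -below_b. Qed.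

Let proper s t : s^[+] = t^[+] -> deg s = deg t -> s = t.
Proof. by move=> st dst; rewrite [s]below_b [t]below_b st dst. Qed.

Let proper_star s t : s^[*] = t^[*] -> deg s = deg t -> s = t.
Proof. by move=> st dst; rewrite [s]below_b_star [t]below_b_star st dst. Qed.

Lemma geometric_model_of_left_strong :
    (forall m n, b m * b n = (b m)^[+] * b (m + n)) ->
  admits_geometric_model S.
Proof.
move=> bls; apply: geometric_model_of_left_division proper_star => // s t st dst.
(* Left strength turns the product into [s^[+] * b (deg t)], which is [t] as [s^[+] = t^[+]]. *)
have sr : s * b (deg t - deg s) = t.
  rewrite {1}[s]below_b -mulgA bls subnKC // mulgA -plusM -below_b st.
  exact/esym/below_b.
(* The quotient is restricted to [s^[*]] so that its plus is exactly [s^[*]]. *)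
exists (s^[*] * b (deg t - deg s)); first by rewrite mulgA mulg_star.
rewrite -[s^[*]]plusS plusM plusS; apply: star_of_plus_mul.
by rewrite sr st.
Qed.

Lemma geometric_model_of_right_strong :
    (forall m n, b m * b n = b (m + n) * (b n)^[*]) ->
  admits_geometric_model S.
Proof.
move=> brs; apply: geometric_model_of_right_division => // s t st dst.
have sr : b (deg t - deg s) * s = t.
  rewrite {2}[s]below_b_star mulgA brs subnK // -mulgA -starM -below_b_star.
  by rewrite st -below_b_star.
exists (b (deg t - deg s) * s^[+]); first by rewrite -mulgA plus_mulg.
rewrite -starP starM starP; apply: plus_of_mul_star.
by rewrite sr st.
Qed.

End Transversal.

(** * Weights on presented birestriction monoids *)

Record weight (A : biunaryType) (d : A -> nat) : Prop := Weight {
  weight1 : d 1 = 0%N;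
  weightM : forall a b, d (a * b) = (d a + d b)%N;
  weight_star : forall a, d a^[*] = 0%N;
  weight_plus : forall a, d a^[+] = 0%N
}.

(** The kernel of a weight is a congruence, so it contains the one generated by [R]. *)
Lemma weight_lift (A : biunaryType) (R : A -> A -> Prop) (d : A -> nat) :
    weight d -> (forall a b, R a b -> d a = d b) ->
  exists2 d' : congr_quot R -> nat,
    weight d' & forall a, d' (\pi_(congr_quot R) a) = d a.
Proof.
move=> [d1 dM dS dP] dR; pose d' (q : congr_quot R) := d (repr q).
have d'E a : d' (\pi_(congr_quot R) a) = d a.
  have /congr_quotP h : \pi_(congr_quot R) (repr (\pi_(congr_quot R) a)) = \pi a.
    exact: reprK.
  apply: (h (fun a b => d a = d b)) => //; split=> //.
  - by move=> ? ? ? -> ->.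
  - by move=> ? ? ? ? ac bd; rewrite !dM ac bd.
  - by move=> *; rewrite !dS.
  - by move=> *; rewrite !dP.
exists d' => //; split.
- by rewrite -[1]pi_one d'E.
- by elim/quotW=> a; elim/quotW=> b; rewrite -pi_mul !d'E dM.
- by elim/quotW=> a; rewrite -pi_star d'E dS.
- by elim/quotW=> a; rewrite -pi_plus d'E dP.
Qed.

Section TermWeight.
Variables (Y : Type) (w : Y -> nat).

Fixpoint term_weight (a : term Y) : nat :=
  match a with
  | Var y => w y
  | Mul a b => term_weight a + term_weight b
  | One | Star _ | Plus _ => 0
  end.

(** The weight descends twice, from terms modulo the laws and then modulo [R]. The intermediate
    weight is known only through its values on generators, hence the quantification over [d]. *)
Lemma presentation_weight (R : free_birestr Y -> free_birestr Y -> Prop) :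
    (forall d : free_birestr Y -> nat, weight d ->
      (forall y, d (free_gen y) = w y) -> forall a b, R a b -> d a = d b) ->
  exists2 d : BRestr R -> nat, weight d & forall y, d (gb_gen (BRestr R) y) = w y.
Proof.
move=> wR; have tw : weight term_weight by [].
have [a b ab|d dw dE] := weight_lift (R := @birestr_law Y) tw.
  by case: ab => * /=; lia.
have [|d' dw' dE'] := weight_lift (A := free_birestr Y) (R := R) (d := d) dw.
  by apply: wR => // y; apply: dE.
by exists d' => // y; rewrite /= /pres_gen dE' [LHS]dE.
Qed.
End TermWeight.

(** * Degree and geometric models of the three monoids *)

Lemma F_monoid_degree (X : Type) (i : N_index) :
  exists2 deg : F_monoid X i -> nat, weight deg &
    forall y, deg (gb_gen (F_monoid X i) y) =
      if y is inr u then size (val u) else 1%N.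
Proof.
apply: presentation_weight => d dw dE.
have ls a b : N_ls a b -> d a = d b.
  by case=> [y|u v];
    rewrite !(weightM dw) ?(weight_star dw) ?(weight_plus dw) !dE //= size_cat.
have rs a b : N_rs a b -> d a = d b.
  by case=> [y|u v];
    rewrite !(weightM dw) ?(weight_star dw) !dE //= size_cat addn0.
by case: i => a b /=; [apply: ls | apply: rs | case; [apply: ls | apply: rs]].
Qed.

Theorem theorem11p3 (X : Type) (x : X) (X_eq_x : forall y : X, y = x)
    (i : N_index) :
  admits_geometric_model (F_monoid X i).
Proof.
have [deg [deg1 degM _ _] deg_gen] := F_monoid_degree X i.
(* Words are non-empty, so [word n] has length [n.+1]; the shift is undone in [b]. *)
pose word n : free_semigroup X := exist _ (nseq n.+1 x) isT.
have wordE u : u = word (size (val u)).-1.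
  case: u => [[|y u] // nu]; apply: eq_exist => /=.
  elim: u y {nu} => [|z u IH] y; first by rewrite (X_eq_x y).
  by rewrite (X_eq_x y) [LHS](congr1 (cons x) (IH z)).
have catE m n : fs_cat (word m) (word n) = word (m + n.+1).
  by rewrite [LHS]wordE; congr word; rewrite /= size_cat /= !size_nseq.
pose B u : F_monoid X i := gb_gen (F_monoid X i) (inr u).
pose b n : F_monoid X i := if n is n'.+1 then B (word n') else 1.
have deg_b n : deg (b n) = n by case: n => [|n] //=; rewrite deg_gen /= size_nseq.
have rel c d : N_rel i c d -> \pi_(congr_quot (N_rel (X := X) i)) c = \pi d.
  by move=> cd; apply/congr_quotP => E _; apply.
have b_letter y : gb_gen (F_monoid X i) (inl y) =
    b 1%N * (gb_gen (F_monoid X i) (inl y))^[*].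
  rewrite /b /B -[word 0]/(fs_letter x) -(X_eq_x y).
  have /rel : N_rel i (letter y) (bar (fs_letter y) * (letter y)^[*]).
    by case: {+}i; [| |left]; constructor.
  by rewrite pi_mul pi_star.
have gen_below y : exists e n, gb_gen (F_monoid X i) y = e^[+] * b n.
  case: y => [y|u].
    by rewrite b_letter restrict_plus; eexists; exists 1%N.
  by exists 1, (size (val u)).-1.+1; rewrite plus1 mul1g /b -wordE.
have model_ls : (forall u v : free_semigroup X,
      N_rel i (bar u * bar v) ((bar u)^[+] * bar (fs_cat u v))) ->
    admits_geometric_model (F_monoid X i).
  move=> ls; have b_ls m n : b m * b n = (b m)^[+] * b (m + n).
    (* The defining relations cover positive [m] and [n]; an index 0 leaves only identities of
       birestriction monoids. *)
    case: m n => [|m] [|n]; rewrite ?addn0 ?mulg1 ?plus_mulg ?mul1g ?plus1 ?mul1g //.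
    rewrite addSn /= -catE.
    by have /rel := ls (word m) (word n); rewrite !pi_mul pi_plus.
  apply: geometric_model_of_left_strong (b_ls) => // m n.
  by exists (b m).
have model_rs : (forall u v : free_semigroup X,
      N_rel i (bar u * bar v) (bar (fs_cat u v) * (bar v)^[*])) ->
    admits_geometric_model (F_monoid X i).
  move=> rs; have b_rs m n : b m * b n = b (m + n) * (b n)^[*].
    case: m n => [|m] [|n]; rewrite ?addn0 ?star1 ?mulg1 ?mul1g ?mulg_star //.
    rewrite addSn /= -catE.
    by have /rel := rs (word m) (word n); rewrite !pi_mul pi_star.
  apply: geometric_model_of_right_strong (b_rs) => // m n.
  (* Right strength gives a restriction on the right, which [restrict_plus] moves to the left. *)
  by rewrite b_rs restrict_plus; eexists.
case: {+}i model_ls model_rs => /= [ls _|_ rs|ls _].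
- by apply: ls; constructor.
- by apply: rs; constructor.
(* [N_s] contains [N_ls], so the left strong case applies. *)
- by apply: ls => u v; left; constructor.
Qed.
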